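(* Let $\lambda$ be a partition of $n$. As rational functions of $x_1,\dots,x_n,t_1,t_2$, $$\sum_{\delta\in\Upsilon_\lambda}\mathbf W^{Coh}(\mathbf t_\delta;x_1,\dots,x_n)=x_r^{-1}\,\frac{\prod_{(i,j)\in\lambda:\ (i+1,j+1)\in\lambda}\big(x_{(i+1,j+1)}-x_{(i,j)}+t_1+t_2\big)}{\prod_{e\in\Gamma_\lambda}\big(x_{h(e)}-x_{t(e)}-\varphi^\lambda_{h(e)}+\varphi^\lambda_{t(e)}\big)},$$ where on the right-hand side the product in the denominator is over all edges $e$ of $\Gamma_\lambda$, and all these edges are oriented from left to right and from bottom to top in the French presentation of $\lambda$ ($h(e)$ and $t(e)$ being the head and tail of $e$ for this orientation).
   Context: $\lambda=(\lambda_1\ge\dots\ge\lambda_l>0)$ is identified with its set of boxes $\Box=(i,j)$, $1\le i\le l$, $1\le j\le\lambda_i$. In the French presentation $(i,j)$ lies in the $i$-th column from the left and $j$-th row from the bottom (so increasing $i$ is moving right and increasing $j$ is moving up). There is one variable $x_\Box$ per box (these are $x_1,\dots,x_n$ in some numbering of boxes), $r=(1,1)$, and $\varphi^\lambda_\Box=(1-j)t_1+(1-i)t_2$. Two boxes are adjacent if they share one coordinate and the other differs by $1$. $\Gamma_\lambda$ is the graph with vertices the boxes of $\lambda$ and edges joining all adjacent boxes. A $\lambda$-tree $\mathbf t$ is a tree with vertex set all boxes of $\lambda$, edges joining only adjacent boxes, rooted at $r$; its canonical orientation directs each edge away from the root. $\kappa_{\mathbf t}$ is the number of edges of $\mathbf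 t$ that in the canonical orientation are vertical and directed down or horizontal and directed left. With $h(e),t(e)$ the head and tail of $e$ in the canonical orientation of $\mathbf t$, $$\mathbf W^{Coh}(\mathbf t;x_1,\dots,x_n)=(-1)^{\kappa_{\mathbf t}}\frac1{x_r}\prod_{e\in\mathbf t}\frac1{x_{h(e)}-x_{t(e)}+\varphi^\lambda_{t(e)}-\varphi^\lambda_{h(e)}}.$$ A reversed-L-shaped subgraph of $\Gamma_\lambda$ is a pair of edges $\gamma=\{\delta_1,\delta_2\}$, $\delta_1$ joining $(i,j),(i+1,j)$ and $\delta_2$ joining $(i+1,j),(i+1,j+1)$, all three boxes in $\lambda$. Let $\gamma_1,\dots,\gamma_m$ be all of them. $\Upsilon_\lambda$ is the set of $2^m$ choices $\delta=(\delta_1,\dots,\delta_m)$ with $\delta_k\in\gamma_k$, and $\mathbf t_\delta=\Gamma_\lambda\setminus\delta$ (remove the chosen edges), which is a $\lambda$-tree. *)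

(* Defs.v *)
From mathcomp Require Import all_boot all_order all_algebra.
From mathcomp Require Import zify.

Set Implicit Arguments.
Unset Strict Implicit.
Unset Printing Implicit Defensive.

Import GRing.Theory.

Record intpart (n : nat) := IntPart {
  parts :> seq nat;
  parts_sorted : sorted geq parts;
  parts_pos : 0 \notin parts;
  parts_sum : sumn parts = n }.

(* The box (i, j), with coordinates starting at 1, is in the i-th column from
   the left and the j-th row from the bottom (French presentation). *)
Definition boxes (s : seq nat) : seq (nat * nat) :=
  [seq (i, j) | i <- iota 1 (size s), j <- iota 1 (nth 0 s i.-1)].

Section Graph.
Variables (n : nat) (lam : intpart n).

Local Notation box := (seq_sub (boxes lam)).
Local Notation edge := {set box}.

Definition colb (b : box) : nat := (val b).1.
Definition rowb (b : box) : nat := (val b).2.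

Definition right_step (u v : box) : bool :=
  (colb v == (colb u).+1) && (rowb v == rowb u).
Definition up_step (u v : box) : bool :=
  (colb v == colb u) && (rowb v == (rowb u).+1).

Definition adjacent (u v : box) : bool :=
  [|| right_step u v, right_step v u, up_step u v | up_step v u].

Definition Gamma : {set edge} :=
  [set e : edge | [exists u, exists v, adjacent u v && (e == [set u; v])]].

Definition edge_rel (t : {set edge}) : rel box :=
  fun u v => ([set u; v] : edge) \in t.

Record ltree := LTree {
  ltree_edges :> {set edge};
  ltree_sub : ltree_edges \subset Gamma;
  ltree_connected : forall u v : box, connect (edge_rel ltree_edges) u v;
  ltree_acyclic : forall c : seq box,
    ucycle (edge_rel ltree_edges) c -> size c <= 2 }.

(* An oriented edge is a pair (tail, head). *)
Local Notation arc := (box * box)%type.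
Definition tail_of (a : arc) : box := a.1.
Definition head_of (a : arc) : box := a.2.
Definition edge_of (a : arc) : edge := [set tail_of a; head_of a].

(* An edge of t points away from r when it is its tail that stays in the
   component of r once the edge is deleted from t. *)
Definition canonical_arcs (r : box) (t : ltree) : {set arc} :=
  [set a : arc | (edge_of a \in (t : {set edge})) &&
     connect (edge_rel ((t : {set edge}) :\ edge_of a)) r (tail_of a)].

Definition left_or_down (a : arc) : bool :=
  right_step (head_of a) (tail_of a) || up_step (head_of a) (tail_of a).

Definition kappa (r : box) (t : ltree) : nat :=
  #|[set a in canonical_arcs r t | left_or_down a]|.

Definition standard_arcs : {set arc} :=
  [set a : arc | (edge_of a \in Gamma) &&
     (right_step (tail_of a) (head_of a) || up_step (tail_of a) (head_of a))].

Definition reversedL : {set {set edge}} :=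
  [set g : {set edge} | [exists a, exists b, exists c,
     [&& right_step a b, up_step b c &
         g == [set ([set a; b] : edge); ([set b; c] : edge)]]]].

Definition is_choice (d : {ffun {g | g \in reversedL} -> edge}) : bool :=
  [forall g, d g \in val g].
Definition Upsilon : finType := {d | is_choice d}.

Definition removed (d : Upsilon) : {set edge} :=
  [set val d g | g : {g | g \in reversedL}].
Definition tree_edges (d : Upsilon) : {set edge} := Gamma :\: removed d.

Lemma mem_boxes i j :
  ((i, j) \in boxes lam) = [&& 0 < i, 0 < j & j <= nth 0 lam i.-1].
Proof.
apply/allpairsPdep/and3P => [[x [y []]]|[i0 j0 hj]].
  by rewrite !mem_iota => hx hy [-> ->]; split; lia.
exists i, j; rewrite !mem_iota; split=> //; last lia.
case: (ltnP i.-1 (size lam)) => [|h]; first lia.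
by move: hj; rewrite nth_default //; lia.
Qed.

Lemma nth_parts i j : i <= j -> nth 0 lam j <= nth 0 lam i.
Proof.
move=> ij; case: (ltnP j (size lam)) => h; last by rewrite (nth_default _ h).
have geq_trans : transitive geq by move=> a b c /= *; lia.
apply: (@sorted_leq_nth _ geq geq_trans leqnn 0 _ (parts_sorted lam)) => //.
by rewrite inE; lia.
Qed.

Lemma boxes_closed i j i' j' : (i, j) \in boxes lam ->
  0 < i' <= i -> 0 < j' <= j -> (i', j') \in boxes lam.
Proof.
rewrite !mem_boxes => /and3P[i0 j0 h] /andP[-> hi] /andP[-> hj] /=.
by apply: leq_trans hj (leq_trans h _); apply: nth_parts; lia.
Qed.

Lemma uniq_boxes : uniq (boxes lam).
Proof.
apply: allpairs_uniq_dep => [|x _|]; rewrite ?iota_uniq //.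
by move=> [a b] [c d] _ _ /= [-> ->].
Qed.

Lemma card_box : #|{: box}| = n.
Proof.
rewrite (card_seq_sub uniq_boxes) size_allpairs_dep; apply: etrans (parts_sum lam).
congr sumn; apply: (@eq_from_nth _ 0) => [|i]; rewrite size_map size_iota //.
by move=> h; rewrite (nth_map 0) ?size_iota ?nth_iota.
Qed.

Lemma mk_box i j : (i, j) \in boxes lam -> exists b : box, colb b = i /\ rowb b = j.
Proof. by move=> h; exists (SeqSub h). Qed.

Lemma box_eq (u v : box) : colb u = colb v -> rowb u = rowb v -> u = v.
Proof.
rewrite /colb /rowb => h1 h2; apply: val_inj.
by case: (val u) (val v) h1 h2 => [? ?] [? ?] /= -> ->.
Qed.

Lemma box_mem (u : box) : (colb u, rowb u) \in boxes lam.
Proof. by have := valP u; rewrite /colb /rowb; case: (val u). Qed.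

Lemma box_gt0 (u : box) : 0 < colb u /\ 0 < rowb u.
Proof. by have := box_mem u; rewrite mem_boxes => /and3P[]. Qed.

Lemma edge_rel_sym t : symmetric (edge_rel t).
Proof. by move=> u v; rewrite /edge_rel setUC. Qed.

Lemma mem_Gamma u v : (([set u; v] : edge) \in Gamma) = adjacent u v.
Proof.
rewrite inE; apply/existsP/idP => [[a /existsP[b /andP[ab /eqP e]]]|uv];
  last by exists u; apply/existsP; exists v; rewrite uv eqxx.
have nab : a != b.
  by apply/eqP => E; move: ab; rewrite /adjacent /right_step /up_step E; lia.
have : u \in [set a; b] by rewrite -e set21.
have : v \in [set a; b] by rewrite -e set22.
have : a \in [set u; v] by rewrite e set21.
have : b \in [set u; v] by rewrite e set22.
rewrite !inE => /orP hb /orP ha /orP hv /orP hu.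
have [[-> ->] //|[-> ->]] : (u = a /\ v = b) \/ (u = b /\ v = a).
  case: hu => /eqP hu; case: hv => /eqP hv; subst; auto.
    by case: hb => /eqP E; rewrite E eqxx in nab.
  by case: ha => /eqP E; rewrite E eqxx in nab.
by move: ab; rewrite /adjacent; case/or4P=> ->; rewrite ?orbT.
Qed.

Lemma set2_eq (a b c d : box) :
  [set a; b] = [set c; d] -> (a = c /\ b = d) \/ (a = d /\ b = c).
Proof.
move=> e; have : a \in [set c; d] by rewrite -e set21.
have : b \in [set c; d] by rewrite -e set22.
have : c \in [set a; b] by rewrite e set21.
have : d \in [set a; b] by rewrite e set22.
by rewrite !inE => /orP[]/eqP-> /orP[]/eqP-> /orP[]/eqP ? /orP[]/eqP ?; subst; auto.
Qed.

Lemma right_stepP u v : right_step u v -> colb v = (colb u).+1 /\ rowb v = rowb u.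
Proof. by case/andP=> /eqP ? /eqP ?. Qed.

Lemma up_stepP u v : up_step u v -> colb v = colb u /\ rowb v = (rowb u).+1.
Proof. by case/andP=> /eqP ? /eqP ?. Qed.

Lemma right_edge_inj a b u v : right_step a b -> right_step u v ->
  [set a; b] = [set u; v] -> a = u /\ b = v.
Proof.
move=> /right_stepP[h1 _] /right_stepP[h2 _] /set2_eq[] // [E1 E2].
by move: h1; rewrite E1 E2; clear E1 E2; lia.
Qed.

Lemma up_edge_inj a b u v : up_step a b -> up_step u v ->
  [set a; b] = [set u; v] -> a = u /\ b = v.
Proof.
move=> /up_stepP[_ h1] /up_stepP[_ h2] /set2_eq[] // [E1 E2].
by move: h1; rewrite E1 E2; clear E1 E2; lia.
Qed.

Lemma right_up_neq a b u v : right_step a b -> up_step u v ->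
  [set a; b] <> [set u; v].
Proof.
move=> /right_stepP[h1 _] /up_stepP[h2 _] /set2_eq[] [E1 E2];
by move: h1; rewrite E1 E2 h2; clear; lia.
Qed.

Lemma mem_removed d (a b c : box) : right_step a b -> up_step b c ->
  (([set a; b] : edge) \in removed d) || (([set b; c] : edge) \in removed d).
Proof.
move=> ab bc.
have gL : [set ([set a; b] : edge); ([set b; c] : edge)] \in reversedL.
  rewrite inE; apply/existsP; exists a; apply/existsP; exists b.
  by apply/existsP; exists c; rewrite ab bc eqxx.
have /forallP/(_ (exist _ (_ : {set edge}) gL)) := valP d; rewrite /= !inE.
by case/orP=> /eqP <-; rewrite imset_f ?orbT.
Qed.

Lemma removedP d e : e \in removed d ->
  exists a b c, [/\ right_step a b, up_step b c &
    (e = [set a; b] /\ ([set b; c] : edge) \notin removed d) \/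
    (e = [set b; c] /\ ([set a; b] : edge) \notin removed d)].
Proof.
have key (g : {g | g \in reversedL}) : exists a b c,
    [/\ right_step a b, up_step b c &
    val g = [set ([set a; b] : edge); ([set b; c] : edge)]].
  have := valP g; rewrite inE => /existsP[a /existsP[b /existsP[c]]].
  by case/and3P=> ? ? /eqP ?; exists a, b, c.
have uniq_L (g h : {g | g \in reversedL}) f :
    f \in val g -> f \in val h -> g = h.
  have [a [b [c [ab bc eg]]]] := key g; have [a' [b' [c' [ab' bc' eh]]]] := key h.
  move=> fg fh; apply: val_inj; rewrite eg eh.
  have [E1 [E2 E3]] : a = a' /\ b = b' /\ c = c'; last by rewrite E1 E2 E3.
  have [h1 h2] := right_stepP ab; have [h3 h4] := right_stepP ab'.
  have [k1 k2] := up_stepP bc; have [k3 k4] := up_stepP bc'.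
  move: fg fh; rewrite eg eh !inE => /orP[]/eqP-> /orP[]/eqP E.
  - have [E1 E2] := right_edge_inj ab ab' E; subst; split=> //; split=> //.
    by apply: box_eq; congruence.
  - by case: (right_up_neq ab bc' E).
  - by case: (right_up_neq ab' bc (esym E)).
  - have [E1 E2] := up_edge_inj bc bc' E; subst; split; last by [].
    by apply: box_eq; [apply: succn_inj|]; congruence.
case/imsetP=> g _ ->; have [a [b [c [ab bc eg]]]] := key g.
exists a, b, c; split=> //.
have /forallP hd := valP d; have := hd g.
have nE : ([set a; b] : edge) != [set b; c] by apply/eqP/right_up_neq.
rewrite {1}eg !inE => /orP[]/eqP eh0; [left|right]; split=> //; apply/imsetP=> -[h _ eh].
  have E : g = h.
    by apply: (uniq_L _ _ [set b; c]); [rewrite eg !inE eqxx orbT|rewrite eh].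
  by move: nE; rewrite -eh0 eh E eqxx.
have E : g = h.
  by apply: (uniq_L _ _ [set a; b]); [rewrite eg !inE eqxx|rewrite eh].
by move: nE; rewrite -eh0 eh E eqxx.
Qed.

Lemma tree_edges_sub d : tree_edges d \subset Gamma.
Proof. exact: subsetDl. Qed.

Lemma tree_edges_connected d (u v : box) : connect (edge_rel (tree_edges d)) u v.
Proof.
set t := tree_edges d.
have csym : connect_sym (edge_rel t) := sym_connect_sym (edge_rel_sym t).
pose N := \max_(b : box) rowb b.
have leN b : rowb b <= N by apply: (@leq_bigmax _ rowb).
have keep (x y : box) : adjacent x y -> ([set x; y] : edge) \notin removed d ->
    connect (edge_rel t) x y.
  by move=> xy h; apply: connect1; rewrite /edge_rel inE h mem_Gamma xy.
(* induction on the column plus the distance of the row to the top *)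
have square k : forall a b c : box, right_step a b -> up_step b c ->
    colb a + (N - rowb a) <= k ->
    connect (edge_rel t) a b /\ connect (edge_rel t) b c.
  elim: k => [|k IH] a b c ab bc hk; first by have := box_gt0 a; lia.
  have [p q] := (andP ab, andP bc).
  have [/eqP p1 /eqP p2] := p; have [/eqP q1 /eqP q2] := q.
  have [a0 a1] := box_gt0 a; have hN := leN c.
  have [|w [w1 w2]] := @mk_box (colb a) (rowb c).
    by apply: boxes_closed (box_mem c) _ _; lia.
  have aw : up_step a w by rewrite /up_step; lia.
  have wc : right_step w c by rewrite /right_step; lia.
  have caw : connect (edge_rel t) a w.
    case h : (([set a; w] : edge) \in removed d); last first.
      by apply: keep; rewrite ?h // /adjacent aw !orbT.
    have [x [y [z [xy yz]]]] := removedP h.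
    case=> -[E _]; first by case: (right_up_neq xy aw).
    have [E1 E2] := up_edge_inj aw yz E; rewrite E1 E2.
    have [h1 h2] := right_stepP xy.
    by apply: (IH _ _ _ xy yz _).2; move: hk; rewrite E1 h1 h2; clear; lia.
  have cwc : connect (edge_rel t) w c.
    case h : (([set w; c] : edge) \in removed d); last first.
      by apply: keep; rewrite ?h // /adjacent wc.
    have [x [y [z [xy yz]]]] := removedP h.
    case=> -[E _]; last by case: (right_up_neq wc yz).
    have [E1 E2] := right_edge_inj wc xy E; rewrite E1 E2.
    apply: (IH _ _ _ xy yz _).1; move: hk hN w1 w2 q2 p2; rewrite -E1.
    by clear; lia.
  have cac := connect_trans caw cwc.
  have kab : ([set a; b] : edge) \notin removed d -> connect (edge_rel t) a b.
    by move=> h; apply: keep; rewrite // /adjacent ab.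
  have kbc : ([set b; c] : edge) \notin removed d -> connect (edge_rel t) b c.
    by move=> h; apply: keep; rewrite // /adjacent bc !orbT.
  have fin1 : connect (edge_rel t) a b -> connect (edge_rel t) b c.
    by move=> h; apply: connect_trans cac; rewrite csym.
  have fin2 : connect (edge_rel t) b c -> connect (edge_rel t) a b.
    by move=> h; apply: connect_trans cac _; rewrite csym.
  case h : (([set a; b] : edge) \in removed d); last first.
    by have h1 := kab (negbT h); split=> //; apply: fin1.
  suff h1 : connect (edge_rel t) b c by split=> //; apply: fin2.
  apply: kbc; have [x [y [z [xy yz]]]] := removedP h.
  case=> -[E hz]; last by case: (right_up_neq ab yz).
  have [_ E2] := right_edge_inj ab xy E; move: hz; rewrite -E2.
  have [z1 z2] := up_stepP yz.
  by rewrite (@box_eq z c); rewrite ?z1 ?z2 -?E2.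
have adj (x y : box) : adjacent x y -> connect (edge_rel t) x y.
  move=> xy; case h : (([set x; y] : edge) \in removed d); last first.
    by apply: keep; rewrite ?h.
  have [a [b [c [ab bc E]]]] := removedP h.
  have [h1 h2] := square _ _ _ _ ab bc (leqnn _).
  by case: E => -[/set2_eq[] [-> ->] _]; rewrite // csym.
suff root k : forall x y : box, colb x + rowb x <= k -> colb y = 1 -> rowb y = 1 ->
    connect (edge_rel t) y x.
  have [|r [r1 r2]] := @mk_box 1 1.
    by apply: boxes_closed (box_mem u) _ _; have := box_gt0 u; lia.
  by apply: connect_trans (root _ _ _ (leqnn _) r1 r2); rewrite csym; apply: root.
elim: k => [|k IH] x y hk y1 y2; have [x1 x2] := box_gt0 x; first lia.
have [c1|c1] := leqP (colb x) 1.
  have [c2|c2] := leqP (rowb x) 1.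
    by rewrite (@box_eq x y); [exact: connect0|lia|lia].
  have [|w [w1 w2]] := @mk_box (colb x) (rowb x).-1.
    by apply: boxes_closed (box_mem x) _ _; lia.
  apply: connect_trans (IH w y _ y1 y2) (adj _ _ _); first lia.
  by rewrite /adjacent /up_step /right_step; lia.
have [|w [w1 w2]] := @mk_box (colb x).-1 (rowb x).
  by apply: boxes_closed (box_mem x) _ _; lia.
apply: connect_trans (IH w y _ y1 y2) (adj _ _ _); first lia.
by rewrite /adjacent /up_step /right_step; lia.
Qed.

(* The lowest of the rightmost boxes of a cycle would be the corner of a
   reversed L with both edges kept. *)
Lemma tree_edges_acyclic d (c : seq box) :
  ucycle (edge_rel (tree_edges d)) c -> size c <= 2.
Proof.
case/andP=> cyc uniq_c; rewrite leqNgt; apply/negP => size_c.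
have [x0 x0c] : exists x0, x0 \in c.
  by case: c size_c {cyc uniq_c} => // x s _; exists x; rewrite mem_head.
pose N := \max_(b : box) rowb b.
have leN b : rowb b <= N by apply: (@leq_bigmax _ rowb).
pose f (b : box) := colb b * N.+1 + (N - rowb b).
have [b bc bmax] : exists2 b, b \in c & forall y, y \in c -> f y <= f b.
  by case: (@arg_maxnP _ x0 [in c] f x0c) => b hb hm; exists b.
have adjb (y : box) : edge_rel (tree_edges d) b y -> y \in c ->
    ([set b; y] : edge) \notin removed d /\ (right_step y b \/ up_step b y).
  rewrite /edge_rel inE => /andP[h]; rewrite mem_Gamma => hadj yc; split=> //.
  have := bmax y yc; have := leN y; have := leN b; move: hadj.
  rewrite /f /adjacent => /or4P[]; auto; rewrite /right_step /up_step; nia.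
set p := prev c b; set q := next c b.
have pc : p \in c by rewrite mem_prev.
have qc : q \in c by rewrite mem_next.
have ep : edge_rel (tree_edges d) b p by rewrite edge_rel_sym prev_cycle.
have ebq : edge_rel (tree_edges d) b q by rewrite next_cycle.
have npq : p != q.
  apply/eqP => E; have qE : next c q = b by rewrite -E /p next_prev.
  have [i s rs] := rot_to bc.
  have := size_c; rewrite -(size_rot i) rs.
  move: qE; rewrite /q -!(next_rot i uniq_c) rs.
  have : uniq (b :: s) by rewrite -rs rot_uniq.
  case: s {rs} => [|y [|z s]] //=.
  rewrite !inE !negb_or !eqxx => /andP[/and3P[by_ bz _] _].
  by rewrite eq_sym (negPf by_) => E2; rewrite E2 eqxx in bz.
have [np hp] := adjb p ep pc; have [nq hq] := adjb q ebq qc.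
case: hp hq => hp [] hq.
- have [h1 h2] := right_stepP hp; have [h3 h4] := right_stepP hq.
  by move/eqP: npq; apply; apply: box_eq; [apply: succn_inj|]; congruence.
- by have := mem_removed d hp hq; rewrite setUC (negPf np) (negPf nq).
- by have := mem_removed d hq hp; rewrite setUC (negPf np) (negPf nq).
- have [h1 h2] := up_stepP hp; have [h3 h4] := up_stepP hq.
  by move/eqP: npq; apply; apply: box_eq; [|apply: succn_inj]; congruence.
Qed.

Definition tree_of (d : Upsilon) : ltree :=
  LTree (tree_edges_sub d) (@tree_edges_connected d) (@tree_edges_acyclic d).

Local Open Scope ring_scope.

Variables (K : fieldType) (x : box -> K) (t1 t2 : K).

Definition phi (b : box) : K :=
  (1 - (rowb b)%:R) * t1 + (1 - (colb b)%:R) * t2.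

Definition Wcoh (r : box) (t : ltree) : K :=
  (-1) ^+ kappa r t * (x r)^-1 *
  \prod_(a in canonical_arcs r t)
     (x (head_of a) - x (tail_of a) + phi (tail_of a) - phi (head_of a))^-1.

End Graph.

Notation box lam := (seq_sub (boxes (parts lam))).

(* Main.v *)
(* Reversing an arc changes the sign of its factor in W, and (-1)^kappa undoes
   exactly these changes, so W(t) is 1/x_r times the product over the edges of
   t of the inverse weights of the edges oriented rightwards or upwards.  Over
   the common denominator (all edges of Gamma) the numerator of W(t_delta) is
   the product of the weights of the removed edges; the reversed L's being
   pairwise disjoint, the sum over all choices factors as the product over the
   reversed L's of the sum of the weights of their two edges, and this sum
   telescopes to x_(i+1,j+1) - x_(i,j) + t1 + t2. *)
Require Import Defs.
From mathcomp Require Import all_boot all_order all_algebra fraction.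
From mathcomp Require Import mpoly.
From mathcomp Require Import zify ring.
Set Implicit Arguments.
Unset Strict Implicit.
Unset Printing Implicit Defensive.
Import GRing.Theory.
Local Open Scope ring_scope.

(** * Standard and canonical orientations of edges *)

Section Arcs.
Variables (n : nat) (lam : intpart n).
Implicit Types (u v : box lam) (a : box lam * box lam) (t : ltree lam).

Lemma Gamma_neq u v : [set u; v] \in Gamma lam -> u != v.
Proof.
rewrite mem_Gamma; apply: contraTneq => ->.
by rewrite /adjacent /right_step /up_step; lia.
Qed.

Lemma edge_of_standard_inj : {in standard_arcs lam &, injective (@edge_of n lam)}.
Proof.
move=> [u v] [u' v']; rewrite !inE /edge_of /tail_of /head_of /=.
case/andP=> _ /orP[h|h] /andP[_ /orP[h'|h']] E.
- by have [-> ->] := right_edge_inj h h' E.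
- by case: (right_up_neq h h' E).
- by case: (right_up_neq h' h (esym E)).
- by have [-> ->] := up_edge_inj h h' E.
Qed.

Lemma edge_of_standard : @edge_of n lam @: standard_arcs lam = Gamma lam.
Proof.
apply/setP => e; apply/imsetP/idP => [[a]|eG]; first by rewrite inE => /andP[h _] ->.
move: (eG); rewrite inE => /existsP[u /existsP[v /andP[uv /eqP E]]].
have Euv : edge_of (u, v) = e by rewrite E.
have Evu : edge_of (v, u) = e by rewrite E /edge_of setUC.
move: uv; rewrite /adjacent => /or4P[] h.
- by exists (u, v); rewrite // inE Euv eG h.
- by exists (v, u); rewrite // inE Evu eG h.
- by exists (u, v); rewrite // inE Euv eG h orbT.
- by exists (v, u); rewrite // inE Evu eG h orbT.
Qed.

(** A simple path from [u] to [v] avoiding the edge has at least two steps, so the edge would close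
    it to a cycle through at least three boxes. *)
Lemma ltree_bridge t u v : [set u; v] \in (t : {set _}) ->
  ~~ connect (edge_rel (ltree_edges t :\ [set u; v])) u v.
Proof.
move=> uvt; have nuv := Gamma_neq (subsetP (ltree_sub t) _ uvt).
apply/negP => /connectP[p0 /shortenP[p pth uniq_p _] E] {p0}.
have /ltree_acyclic : ucycle (edge_rel (ltree_edges t)) (u :: p).
  rewrite /ucycle uniq_p andbT /= rcons_path -E edge_rel_sym {2}/edge_rel uvt andbT.
  by apply: sub_path pth => y z; rewrite /edge_rel in_setD1 => /andP[].
case: p E pth {uniq_p} => [|w [|z p]] //= E; first by rewrite E eqxx in nuv.
by rewrite /edge_rel E !inE eqxx.
Qed.

(** If both orientations of an edge pointed away from [r], both ends would be joined to [r], hence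
    to each other, without that edge, against [ltree_bridge]. *)
Lemma edge_of_canonical_inj r t : {in canonical_arcs r t &, injective (@edge_of n lam)}.
Proof.
move=> [u v] [u' v']; rewrite !inE /edge_of /tail_of /head_of /=.
case/andP=> uvt ru /andP[_ ru'] E.
have [[-> ->] //|[eu ev]] := set2_eq E.
case/negP: (ltree_bridge uvt); move: ru'; rewrite -E -ev => rv.
apply: connect_trans rv; rewrite (sym_connect_sym (edge_rel_sym _)) //.
Qed.

Lemma edge_of_canonical r t :
  @edge_of n lam @: canonical_arcs r t = ltree_edges t.
Proof.
apply/setP => e; apply/imsetP/idP => [[a]|et]; first by rewrite inE => /andP[h _] ->.
have := subsetP (ltree_sub t) _ et.
rewrite inE => /existsP[u /existsP[v /andP[_ /eqP E]]].
have Euv : edge_of (u, v) = e by rewrite E.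
have Evu : edge_of (v, u) = e by rewrite E /edge_of setUC.
set f := edge_rel (ltree_edges t :\ e).
have fsym : connect_sym f := sym_connect_sym (edge_rel_sym _).
have [ru|nru] := boolP (connect f r u).
  by exists (u, v); rewrite // inE Euv et.
have [rv|nrv] := boolP (connect f r v).
  by exists (v, u); rewrite // inE Evu et.
(* If [r] reaches neither end of [e] once [e] is deleted, putting [e] back does not enlarge the
   component of [r], although [t] is connected. *)
have : closed (edge_rel (ltree_edges t)) (connect f r).
  move=> y z yz; have [eyz|neyz] := eqVneq [set y; z] e; last first.
    have cyz : connect f y z by apply: connect1; rewrite /f /edge_rel !inE neyz.
    by rewrite -!topredE /= fsym (same_connect fsym cyz) fsym.
  rewrite -!topredE /=; move: eyz; rewrite E.
  by case/set2_eq => -[-> ->]; rewrite (negPf nru) (negPf nrv).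
move=> cl; have := closed_connect cl (ltree_connected t r u).
by rewrite -!topredE /= connect0 (negPf nru).
Qed.

End Arcs.

(** * Reversed L's and diagonal pairs of boxes *)

Section ReversedL.
Variables (n : nat) (lam : intpart n).
Implicit Types (a b c : box lam).

Lemma reversedL_disjoint a b c a' b' c' e :
  right_step a b -> up_step b c -> right_step a' b' -> up_step b' c' ->
  e \in [set [set a; b]; [set b; c]] -> e \in [set [set a'; b']; [set b'; c']] ->
  a = a' /\ c = c'.
Proof.
move=> ab bc ab' bc'.
have [h1 h2] := right_stepP ab; have [h3 h4] := right_stepP ab'.
have [k1 k2] := up_stepP bc; have [k3 k4] := up_stepP bc'.
rewrite !inE => /orP[]/eqP-> /orP[]/eqP E.
- have [E1 E2] := right_edge_inj ab ab' E; subst; split=> //.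
  by apply: box_eq; congruence.
- by case: (right_up_neq ab bc' E).
- by case: (right_up_neq ab' bc (esym E)).
- have [E1 E2] := up_edge_inj bc bc' E; subst; split; last by [].
  by apply: box_eq; [apply: succn_inj|]; congruence.
Qed.

(** The index set of the numerator; completing such a pair by its lower right corner matches it with
    a unique reversed L. *)
Definition diagonal (p : box lam * box lam) : bool :=
  (colb p.2 == (colb p.1).+1) && (rowb p.2 == (rowb p.1).+1).

Definition corner (p : box lam * box lam) : box lam :=
  odflt p.1 [pick b | right_step p.1 b && up_step b p.2].

Definition diagonalL (p : box lam * box lam) : {set {set box lam}} :=
  [set [set p.1; corner p]; [set corner p; p.2]].

(** The box just below [p.2] belongs to the diagram, which is closed under decreasing coordinates,
    so the default in [corner] is not taken here. *)
Lemma cornerP p : diagonal p -> right_step p.1 (corner p) /\ up_step (corner p) p.2.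
Proof.
case/andP=> /eqP h1 /eqP h2; rewrite /corner; case: pickP => [b /andP[] //|no].
have [c0 r0] := box_gt0 p.1.
have [|b [b1 b2]] := @mk_box _ lam (colb p.2) (rowb p.1).
  by apply: boxes_closed (box_mem p.2) _ _; lia.
by have := no b; rewrite /right_step /up_step b1 b2 h1 h2 !eqxx.
Qed.

Lemma diagonalL_inj : {in diagonal &, injective diagonalL}.
Proof.
move=> [a c] [a' c'] /cornerP[ab bc] /cornerP[ab' bc'] E.
have h : [set a; corner (a, c)] \in diagonalL (a, c) by rewrite !inE eqxx.
have h' := h; rewrite E in h'.
by have [/= -> ->] := reversedL_disjoint ab bc ab' bc' h h'.
Qed.

Lemma diagonalL_imset : [set diagonalL p | p in diagonal] = reversedL lam.
Proof.
apply/setP => g; apply/imsetP/idP => [[p /cornerP[ab bc] ->]|].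
  rewrite inE; apply/existsP; exists p.1; apply/existsP; exists (corner p).
  by apply/existsP; exists p.2; rewrite ab bc eqxx.
rewrite inE => /existsP[a /existsP[b /existsP[c /and3P[ab bc /eqP ->]]]].
have [h1 h2] := right_stepP ab; have [k1 k2] := up_stepP bc.
have D : diagonal (a, c) by rewrite /diagonal /= k1 k2 h1 h2 !eqxx.
exists (a, c) => //; have [/right_stepP[p1 p2] _] := cornerP D.
have Eb : corner (a, c) = b by apply: box_eq; [rewrite p1 h1|rewrite p2 h2].
by rewrite /diagonalL Eb.
Qed.

Lemma reversedL_sub g : g \in reversedL lam -> g \subset Gamma lam.
Proof.
rewrite inE => /existsP[a /existsP[b /existsP[c /and3P[ab bc /eqP ->]]]].
by rewrite subUset !sub1set !mem_Gamma /adjacent ab bc !orbT.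
Qed.

(** Disjoint reversed L's cannot share a chosen edge. Hence a product over [removed d] is a product
    over the reversed L's, without collapsed factors. *)
Lemma choice_inj (d : Upsilon lam) : injective (val d).
Proof.
move=> g h E; have /forallP hd := valP d; apply: val_inj.
have repr (k : {k | k \in reversedL lam}) : exists2 p, diagonal p & val k = diagonalL p.
  have : val k \in diagonalL @: diagonal by rewrite diagonalL_imset (valP k).
  by case/imsetP=> p; exists p.
have [[a c] D eg] := repr g; have [[a' c'] D' eh] := repr h.
have := hd h; have := hd g; rewrite E eg eh => dg dh.
have [[ab bc] [ab' bc']] := (cornerP D, cornerP D').
by have [/= -> ->] := reversedL_disjoint ab bc ab' bc' dg dh.
Qed.

Lemma removed_sub (d : Upsilon lam) : removed d \subset Gamma lam.
Proof.
apply/subsetP => _ /imsetP[g _ ->]; have /forallP/(_ g) hd := valP d.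
exact: (subsetP (reversedL_sub (valP g))).
Qed.

End ReversedL.

(** * Edge weights and summation over the choices *)

Section Weights.
Variables (n : nat) (lam : intpart n) (K : fieldType).
Variables (x : box lam -> K) (t1 t2 : K).

Definition weight (a : box lam * box lam) : K :=
  x (head_of a) - x (tail_of a) + phi t1 t2 (tail_of a) - phi t1 t2 (head_of a).

(* For an edge of Gamma this product has a single factor. *)
Definition edge_weight (e : {set box lam}) : K :=
  \prod_(a in standard_arcs lam | edge_of a == e) weight a.

Lemma edge_weight_standard a : a \in standard_arcs lam ->
  edge_weight (edge_of a) = weight a.
Proof.
move=> sa; rewrite /edge_weight (big_pred1 a) // => b.
apply/andP/eqP => [[sb /eqP]|->]; last by rewrite sa eqxx.
exact: edge_of_standard_inj.
Qed.

(** Exactly one of the two orientations is standard, and swapping tail and head negates [weight]. *)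
Lemma edge_weight_sign a : edge_of a \in Gamma lam ->
  edge_weight (edge_of a) = (-1) ^+ left_or_down a * weight a.
Proof.
case: a => u v aG; have uv : adjacent u v by rewrite -mem_Gamma.
rewrite /left_or_down /=.
have [suv|nsuv] := boolP (right_step u v || up_step u v).
  rewrite edge_weight_standard; last by rewrite inE aG.
  suff /negPf -> : ~~ (right_step v u || up_step v u) by rewrite mul1r.
  case/orP: suv => [/right_stepP|/up_stepP] [h1 h2]; apply/negP;
    case/orP=> [/right_stepP|/up_stepP] [h3 h4]; lia.
have svu : right_step v u || up_step v u.
  by case/or4P: uv nsuv => -> //; rewrite ?orbT.
have -> : edge_of (u, v) = edge_of (v, u) by rewrite /edge_of setUC.
rewrite svu expr1 edge_weight_standard; first by rewrite /weight /=; ring.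
by rewrite inE svu andbT /edge_of setUC.
Qed.

Lemma prod_standard :
  \prod_(a in standard_arcs lam) weight a = \prod_(e in Gamma lam) edge_weight e.
Proof.
rewrite -edge_of_standard (big_imset _ (@edge_of_standard_inj _ lam)) /=.
by apply: eq_bigr => a /edge_weight_standard ->.
Qed.

Lemma Wcoh_edges r (t : ltree lam) :
  Wcoh x t1 t2 r t = (x r)^-1 * \prod_(e in ltree_edges t) (edge_weight e)^-1.
Proof.
rewrite /Wcoh -(edge_of_canonical r t) (big_imset _ (@edge_of_canonical_inj _ lam r t)) /=.
(* The global sign is spread over the arcs, where each local sign, being its own inverse, turns an
   arc weight into an edge weight. *)
have -> : (-1) ^+ kappa r t =
    \prod_(a in canonical_arcs r t) (-1) ^+ left_or_down a :> K.
  rewrite /kappa -prodr_const (eq_bigl _ _ (fun a => in_set _ a)) big_mkcondr.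
  by apply: eq_bigr => a _; case: ifP.
rewrite mulrAC mulrC -big_split; congr (_ * _); apply: eq_bigr => a.
rewrite inE => /andP[/(subsetP (ltree_sub t)) aG _].
by rewrite edge_weight_sign // invfM invr_sign.
Qed.

(** The variable of the corner cancels; the [phi] differences give [t2] for the right step and [t1]
    for the up step. *)
Lemma weight_diagonal p : diagonal p ->
  \sum_(e in diagonalL p) edge_weight e = x p.2 - x p.1 + t1 + t2.
Proof.
case: p => a c D; have [ab bc] := cornerP D; rewrite /diagonalL /=.
set b := corner _ in ab bc *.
rewrite big_setU1 /=; last by rewrite inE; apply/eqP/right_up_neq.
rewrite big_set1 (@edge_weight_standard (a, b)); last first.
  by rewrite inE /edge_of mem_Gamma /adjacent /= ab.
rewrite (@edge_weight_standard (b, c)); last first.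
  by rewrite inE /edge_of mem_Gamma /adjacent /= bc !orbT.
rewrite /weight /phi /=.
have [-> ->] := up_stepP bc; have [-> ->] := right_stepP ab.
by rewrite -!natr1; ring.
Qed.

Lemma sum_removed :
  \sum_(d : Upsilon lam) \prod_(e in removed d) edge_weight e =
  \prod_(p | diagonal p) (x p.2 - x p.1 + t1 + t2).
Proof.
transitivity (\prod_(g in reversedL lam) \sum_(e in g) edge_weight e).
  (* Expanding the product of sums yields a sum over choice functions; [big_sub] first passes to the
     subtype of reversed L's, later to [Upsilon]. *)
  rewrite [RHS]big_sub bigA_distr_big_dep.
  rewrite (eq_bigl (fun d => is_choice d)); last by move=> d; apply/familyP/forallP.
  rewrite [RHS]big_sub; apply: eq_bigr => d _.
  by rewrite /removed big_imset //= => g h _ _; apply: choice_inj.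
rewrite -diagonalL_imset big_imset; last exact: diagonalL_inj.
by apply: eq_bigr => p /weight_diagonal.
Qed.

Lemma sum_Wcoh r : (forall a, a \in standard_arcs lam -> weight a != 0) ->
  \sum_(d : Upsilon lam) Wcoh x t1 t2 r (tree_of d) =
  (x r)^-1 * ((\prod_(p | diagonal p) (x p.2 - x p.1 + t1 + t2)) /
    \prod_(a in standard_arcs lam) weight a).
Proof.
move=> w0; rewrite -sum_removed mulr_suml mulr_sumr; apply: eq_bigr => d _.
rewrite Wcoh_edges prod_standard; congr (_ * _).
have nz (A : {set {set box lam}}) :
    A \subset Gamma lam -> \prod_(e in A) edge_weight e != 0.
  move=> AG; apply/prodf_neq0 => e /(subsetP AG).
  by rewrite -edge_of_standard => /imsetP[a sa ->]; rewrite edge_weight_standard ?w0.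
(* The denominator splits into removed and kept edges, and the removed ones cancel against the
   numerator. *)
rewrite prodfV [X in _ / X](big_setID (removed d)) /= (setIidPr (removed_sub d)).
by rewrite invfM mulVKf ?nz ?removed_sub.
Qed.

End Weights.

(** * The identity between rational functions *)

Theorem proposition14 (F : fieldType) (n : nat) (lam : intpart n)
  (num : box lam -> 'I_n) (num_bij : bijective num)
  (r : box lam) (r_root : val r = (1, 1)%N) :
  let K : fieldType := {fraction {mpoly F[n + 2]}} in
  let x (b : box lam) : K := tofrac ('X_(lshift 2 (num b)) : {mpoly F[n + 2]}) in
  let t1 : K := tofrac ('X_(rshift n (0 : 'I_2)) : {mpoly F[n + 2]}) in
  let t2 : K := tofrac ('X_(rshift n (1 : 'I_2)) : {mpoly F[n + 2]}) in
  \sum_(d : Upsilon lam) Wcoh x t1 t2 r (tree_of d) =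
  (x r)^-1 *
  ((\prod_(p : box lam * box lam |
       (colb p.2 == (colb p.1).+1) && (rowb p.2 == (rowb p.1).+1))
      (x p.2 - x p.1 + t1 + t2)) /
   (\prod_(e in standard_arcs lam)
      (x (head_of e) - x (tail_of e) - phi t1 t2 (head_of e) + phi t1 t2 (tail_of e)))).
Proof.
move=> K x t1 t2; rewrite sum_Wcoh; last first.
  move=> [u v]; rewrite inE /tail_of /head_of /= => /andP[_ st].
  (* Only the nonvanishing of the weights is at stake: each is the image of a polynomial, the
     difference of two box variables plus [t1] or [t2]. *)
  suff : exists2 p : {mpoly F[n + 2]}, p != 0 & weight x t1 t2 (u, v) = tofrac p.
    by case=> p p0 ->; rewrite tofrac_eq0.
  have nuv : u != v.
    by apply: contraTneq st => ->; rewrite /right_step /up_step; lia.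
  have nz i : 'X_(lshift 2 (num v)) - 'X_(lshift 2 (num u)) + 'X_(rshift n i)
      != 0 :> {mpoly F[n + 2]}.
    apply: contra_neq (oner_neq0 F).
    (* At the point where the variable of [v] is 1 and all others are 0, the polynomial takes the
       value 1, as [num] separates [u] from [v]. *)
    move/(congr1 (meval (fun k => (k == lshift 2 (num v))%:R))).
    rewrite !rmorphE /= !mevalXU eqxx eq_rlshift.
    by rewrite eq_lshift (inj_eq (bij_inj num_bij)) (negPf nuv) subr0 addr0.
  case/orP: st => [/right_stepP|/up_stepP] [h1 h2].
    exists ('X_(lshift 2 (num v)) - 'X_(lshift 2 (num u)) + 'X_(rshift n 1)) => //.
    rewrite rmorphD rmorphB -/(x u) -/(x v) -/t2 /weight /phi /= h1 h2 -natr1.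
    ring.
  exists ('X_(lshift 2 (num v)) - 'X_(lshift 2 (num u)) + 'X_(rshift n 0)) => //.
  rewrite rmorphD rmorphB -/(x u) -/(x v) -/t1 /weight /phi /= h1 h2 -natr1.
  ring.
congr (_ * (_ / _)); apply: eq_bigr => a _.
by rewrite /weight; ring.
Qed.
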